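(* Let $n\ge 2$ and let $\mathfrak{h}^3\oplus\mathbb{R}^{2n-3}$ be the real Lie algebra with basis $\{e_1,\ldots,e_{2n}\}$ and bracket relation $[e_1,e_2]=e_{2n}$. For every symplectic structure $\omega$ on $\mathfrak{h}^3\oplus\mathbb{R}^{2n-3}$ there exists a Lagrangian ideal.
   Context: All brackets of basis vectors not determined by the listed one through antisymmetry are zero. A symplectic structure on a Lie algebra $\mathfrak{g}$ is a nondegenerate alternating bilinear form $\omega$ on $\mathfrak{g}$ satisfying $\omega(x,[y,z])+\omega(z,[x,y])+\omega(y,[z,x])=0$ for all $x,y,z\in\mathfrak{g}$. For a subspace $W$, $W^\perp=\{v\in\mathfrak{g}\mid\omega(v,w)=0\text{ for all }w\in W\}$. A Lagrangian ideal is an ideal $\mathfrak{l}$ of $\mathfrak{g}$ with $\mathfrak{l}=\mathfrak{l}^\perp$. *)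

(* Defs.v *)
From mathcomp Require Import all_boot all_order all_algebra.
From mathcomp Require Import reals.

Set Implicit Arguments.
Unset Strict Implicit.
Unset Printing Implicit Defensive.

Import GRing.Theory.
Local Open Scope ring_scope.

Definition is_lie_bracket (F : fieldType) (g : vectType F)
    (br : {bilinear g -> g -> g}) : Prop :=
  (forall x, br x x = 0) /\
  (forall x y z, br x (br y z) + br y (br z x) + br z (br x y) = 0).

(* Indices start at 0: e`_0, e`_1 and e`_(2 * n).-1 are the basis vectors
   e_1, e_2 and e_{2n}. The brackets with i >= j follow by antisymmetry. *)
Definition h3_abelian_relations (F : fieldType) (g : vectType F) (n : nat)
    (br : {bilinear g -> g -> g}) (e : (2 * n).-tuple g) : Prop :=
  br e`_0 e`_1 = e`_(2 * n).-1 /\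
  (forall i j : nat, (i < j < 2 * n)%N -> (i, j) <> (0%N, 1%N) ->
     br e`_i e`_j = 0).

Definition is_symplectic_structure (F : fieldType) (g : vectType F)
    (br : {bilinear g -> g -> g}) (omega : {biscalar g}) : Prop :=
  [/\ forall x, omega x x = 0,
      forall x, (forall y, omega x y = 0) -> x = 0 &
      forall x y z,
        omega x (br y z) + omega z (br x y) + omega y (br z x) = 0].

Definition perp (F : fieldType) (g : vectType F) (omega : {biscalar g})
    (W : {vspace g}) (v : g) : Prop :=
  forall w, w \in W -> omega v w = 0.

Definition is_ideal (F : fieldType) (g : vectType F)
    (br : {bilinear g -> g -> g}) (l : {vspace g}) : Prop :=
  forall x y, y \in l -> br x y \in l.

Definition is_lagrangian_ideal (F : fieldType) (g : vectType F)
    (br : {bilinear g -> g -> g}) (omega : {biscalar g})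
    (l : {vspace g}) : Prop :=
  is_ideal br l /\ (forall v, v \in l <-> perp omega l v).

(* Main.v *)
Require Import Defs.
From mathcomp Require Import all_boot all_order all_algebra.
From mathcomp Require Import boolp reals.

(* The derived algebra is spanned by e_{2n}, so every subspace containing
   e_{2n} is an ideal. The line through e_{2n} is isotropic, hence contained in
   a maximal isotropic subspace, which equals its own orthogonal. *)

Import GRing.Theory.
Local Open Scope ring_scope.

Definition isotropic {F : fieldType} {g : vectType F} (omega : {biscalar g})
    (U : {vspace g}) : Prop :=
  forall v, v \in U -> perp omega U v.

(** Polarization: expand [b (x + y) (x + y) = 0]. The scalings [s] and [s'] stay arbitrary so that
    both the bracket and the form [omega] are covered. *)
Lemma alternating_skew {R : nzRingType} {U : lmodType R} {V : zmodType}
    {s s' : R -> V -> V} (b : {bilinear U -> U -> V | s & s'}) :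
  (forall x, b x x = 0) -> forall x y, b x y = - b y x.
Proof.
move=> b0 x y; apply/eqP; rewrite -addr_eq0.
by have := b0 (x + y); rewrite linearDl !linearDr !b0 add0r addr0 => ->.
Qed.

Lemma isotropic_line {F : fieldType} {g : vectType F} {omega : {biscalar g}} :
  (forall x, omega x x = 0) -> forall z, isotropic omega <[z]>%VS.
Proof.
move=> omega0 z v /vlineP[a ->] w /vlineP[b ->].
by rewrite linearZl_LR linearZr_LR omega0 !mulr0.
Qed.

(** Of the four terms of the expanded form, two vanish because [U] and the line are isotropic, the
    two mixed ones because [v] is orthogonal to [U], on either side by skew symmetry. *)
Lemma isotropic_add_line {F : fieldType} {g : vectType F}
    {omega : {biscalar g}} (omega0 : forall x, omega x x = 0)
    {U : {vspace g}} {v : g} :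
  isotropic omega U -> perp omega U v -> isotropic omega (U + <[v]>)%VS.
Proof.
move=> isoU vU x /memv_addP[u uU [a av ->]] y /memv_addP[w wU [b bv ->]].
have ab0 : omega a b = 0 by apply: isotropic_line av _ bv.
case/vlineP: av ab0 => s ->; case/vlineP: bv => t -> ab0.
rewrite linearDl !linearDr ab0 (isoU u uU w wU) linearZr_LR linearZl_LR.
by rewrite (alternating_skew _ omega0 u v) !vU // oppr0 !mulr0 !addr0.
Qed.

(** Induction on the codimension of [U]: as long as some vector orthogonal to [U] lies outside [U],
    it is adjoined. *)
Lemma isotropic_sub_lagrangian {F : fieldType} {g : vectType F}
    {omega : {biscalar g}} (omega0 : forall x, omega x x = 0)
    (U : {vspace g}) :
  isotropic omega U ->
  exists2 L : {vspace g}, (U <= L)%VS & forall v, v \in L <-> perp omega L v.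
Proof.
have [k] := ubnP (\dim {:g} - \dim U); elim: k U => // k IHk U leUk isoU.
have [[v vU vNU] | maxU] := pselect (exists2 v, perp omega U v & v \notin U).
  have ltU : (\dim U < \dim (U + <[v]>))%N.
    (* Equal dimensions would force [U = U + <[v]>] and so put [v] in [U]. *)
    rewrite ltn_neqAle dimvS ?addvSl // andbT.
    apply: contra vNU => /eqP dimU.
    have /eqP -> : U == (U + <[v]>)%VS by rewrite eqEdim addvSl dimU leqnn.
    by rewrite memvE addvSr.
  have [|L UvL LP] := IHk (U + <[v]>)%VS _ (isotropic_add_line omega0 isoU vU).
    (* Subtraction on [nat] is truncated, so a strict decrease also requires
       [\dim U < \dim {:g}]. *)
    rewrite -ltnS; apply: leq_trans leUk; rewrite ltnS ltn_sub2l //.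
    by apply: leq_trans ltU (dimvS (subvf _)).
  by exists L => //; apply: subv_trans UvL; apply: addvSl.
(* No vector orthogonal to [U] is left outside it, so [U] equals its orthogonal. *)
exists U => // v; split=> [|vU]; first exact: isoU.
by apply/negPn/negP => vNU; apply: maxU; exists v.
Qed.

(** Expanding both arguments in the basis makes [b x y] a linear combination of values of [b] on
    pairs of basis vectors. *)
Lemma bilinear_basis_mem {F : fieldType} {U V : vectType F} {m : nat}
    (b : {bilinear U -> U -> V}) {e : m.-tuple U} {W : {vspace V}} :
  basis_of fullv e -> (forall i j : 'I_m, b e`_i e`_j \in W) ->
  forall x y, b x y \in W.
Proof.
move=> he bW x y.
rewrite (coord_basis he (memvf x)) (coord_basis he (memvf y)).
rewrite linear_sumlz memv_suml // => i _; rewrite linear_sumr memv_suml // => j _.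
by rewrite linearZl_LR linearZr_LR !memvZ.
Qed.

Lemma h3_abelian_bracket_mem {F : fieldType} {g : vectType F} {n : nat}
    {br : {bilinear g -> g -> g}} {e : (2 * n).-tuple g} :
  is_lie_bracket br -> basis_of fullv e -> h3_abelian_relations br e ->
  forall x y, br x y \in <[e`_(2 * n).-1]>%VS.
Proof.
move=> [br0 _] he [br01 brE]; apply: (bilinear_basis_mem br he) => i j.
have ltP (k l : 'I_(2 * n)) : (k < l)%N ->
    br e`_k e`_l \in <[e`_(2 * n).-1]>%VS.
  move=> ltkl; have [[-> ->] | /eqP kl] := @eqP _ (val k, val l) (0%N, 1%N).
    by rewrite br01 memv_line.
  by rewrite brE ?mem0v ?ltkl ?ltn_ord //; apply/eqP.
(* The relations list only increasing pairs: a decreasing pair gives the negative of a listed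
   bracket, and the diagonal vanishes by alternation. *)
case: (ltngtP i j) => [/ltP // | ltji | ->]; last by rewrite br0 mem0v.
by rewrite (alternating_skew _ br0) memvN ltP.
Qed.

Theorem corollary5p9 (R : realType) (n : nat) (hn : (2 <= n)%N)
    (g : vectType R) (br : {bilinear g -> g -> g}) (hbr : is_lie_bracket br)
    (e : (2 * n).-tuple g) (he : basis_of fullv e)
    (hrel : h3_abelian_relations br e)
    (omega : {biscalar g}) (homega : is_symplectic_structure br omega) :
  exists l : {vspace g}, is_lagrangian_ideal br omega l.
Proof.
case: homega => omega0 _ _.
have [L zL LP] := isotropic_sub_lagrangian omega0 _
  (isotropic_line omega0 e`_(2 * n).-1).
exists L; split=> // x y _.
exact: subvP zL _ (h3_abelian_bracket_mem hbr he hrel x y).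
Qed.
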